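(* Let $(X,\le_X)$ be a partially ordered set. The following are equivalent. (i) Every cardinally indecomposable component $B$ of $X$ (with the order induced from $X$) is order-isomorphic to some subset $C_B\subseteq\mathbb{Z}$ with the usual order. (ii) For every $A\subseteq X$ and every poset $(Y,\le_Y)$, every isotone map $f\colon A\to Y$ can be extended to an isotone map $g\colon X\to Y$ (i.e. $g|_A=f$).
   Context: Two elements $a,b$ of a poset are comparable if $a\le b$ or $b\le a$. Define $a\,\rho\, b$ iff there is a finite sequence $a_1,\dots,a_m$ with $a_1=a$, $a_m=b$ and $a_i,a_{i+1}$ comparable for $i=1,\dots,m-1$; $\rho$ is an equivalence relation, and its equivalence classes are the cardinally indecomposable components of $X$. A map is isotone if $x\le y$ implies $f(x)\le f(y)$; subsets carry the induced order.
   Formalization: In (ii) the poset Y is required to be nonempty; otherwise, with X a single point and A and Y empty, (i) holds but the empty map from A to Y has no extension to X. *)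

(* Defs.v *)
From HB Require Import structures.
From mathcomp Require Import all_boot all_order ssrint.
From mathcomp Require Import boolp classical_sets.

Set Implicit Arguments.
Unset Strict Implicit.
Unset Printing Implicit Defensive.

Import Order.TTheory.

Local Open Scope classical_set_scope.
Local Open Scope order_scope.

(* The induced order on a subtype: [x <= y] means [val x <= val y]. It applies
   to a set [A] used as a type, which is by definition [{x | x \in A}]. *)
HB.instance Definition _ (d : Order.disp_t) (T : porderType d) (P : pred T) :=
  [SubChoice_isSubPOrder of {x : T | P x} by <: with d].

Definition isotone (d d' : Order.disp_t) (X : porderType d)
    (Y : porderType d') (f : X -> Y) : Prop :=
  {homo f : x y / x <= y}.

Definition order_isomorphic (d d' : Order.disp_t) (X : porderType d)
    (Y : porderType d') : Prop :=
  exists f : X -> Y, bijective f /\ {mono f : x y / x <= y}.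

(* The sequence of the definition of rho is [a :: s], hence never empty. *)
Definition rho (d : Order.disp_t) (X : porderType d) (a b : X) : Prop :=
  exists s : seq X, path >=<%O a s /\ last a s = b.

Definition cardinally_indecomposable_component (d : Order.disp_t)
    (X : porderType d) (B : set X) : Prop :=
  exists a : X, B = [set b | rho a b].

Lemma rho_refl (d : Order.disp_t) (X : porderType d) (a : X) : rho a a.
Proof. by exists [::]. Qed.

Lemma rho_sym (d : Order.disp_t) (X : porderType d) (a b : X) :
  rho a b -> rho b a.
Proof.
case=> s [ps <-]; exists (rev (belast a s)); split.
  rewrite rev_path; apply: sub_path ps => x y /=.
  by rewrite comparable_sym.
by case: s {ps} => //= x s; rewrite rev_cons last_rcons.
Qed.

Lemma rho_trans (d : Order.disp_t) (X : porderType d) (a b c : X) :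
  rho a b -> rho b c -> rho a c.
Proof.
case=> s [ps <-] [t [pt <-]]; exists (s ++ t).
by rewrite cat_path last_cat ps pt.
Qed.

(* Main.v *)
(* An isotone map from a subset [A] of a disjoint union of subsets of the
   integers extends by sending [x] to the image of the greatest element of [A]
   below [x] or, failing that, of the least element of [A] above [x].
   Conversely, extending the identity of [A] makes every nonempty [A] an isotone
   retract of [X]. A retraction onto a two-element antichain is constant on
   components, so components are chains; a retraction onto a bounded set sends a
   bound to a greatest (or least) element. In such a chain every element has a
   successor unless it is maximal, and [x <= y] forces [y] to be an iterated
   successor of [x], so counting successors from a base point embeds the chain
   in the integers. *)
Require Import Defs.
From mathcomp Require Import all_boot all_order ssrint.
From mathcomp Require Import boolp classical_sets.
From mathcomp Require Import zify.

Set Implicit Arguments.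
Unset Strict Implicit.
Unset Printing Implicit Defensive.

Import Order.TTheory.

Local Open Scope classical_set_scope.
Local Open Scope order_scope.

(** Comparability within components, this property and its dual are all that either direction uses
    about the integers. *)
Definition bounded_have_max (d : Order.disp_t) (T : porderType d) : Prop :=
  forall (S : set T) (u : T), S !=set0 -> (forall s, S s -> s <= u) ->
  exists2 m, S m & forall s, S s -> s <= m.

Definition bounded_have_min (d : Order.disp_t) (T : porderType d) : Prop :=
  forall (S : set T) (l : T), S !=set0 -> (forall s, S s -> l <= s) ->
  exists2 m, S m & forall s, S s -> m <= s.

(** Nonemptiness of [A] makes it an inhabited target, so that the identity of [A] can be
    extended. *)
Definition all_subsets_retract (d : Order.disp_t) (X : porderType d) : Prop :=
  forall A : set X, A !=set0 ->
  exists g : X -> X, [/\ isotone g, forall x, A (g x) & forall a, A a -> g a = a].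

Lemma exists_argmin (T : Type) (S : set T) (h : T -> nat) :
  S !=set0 -> exists2 m, S m & forall s, S s -> (h m <= h s)%N.
Proof.
move=> [s0 Ss0].
have ex : exists n, `[< exists2 s, S s & h s = n >].
  by exists (h s0); apply/asboolP; exists s0.
case: (ex_minnP ex) => n /asboolP[m Sm <-] minm.
by exists m => // s Ss; apply: minm; apply/asboolP; exists s.
Qed.

Lemma le_rho (d : Order.disp_t) (X : porderType d) (x y : X) :
  x <= y -> rho x y.
Proof. by move=> xy; exists [:: y]; rewrite /= /Order.comparable xy. Qed.

Lemma rho_invariant (d : Order.disp_t) (X : porderType d) (T : Type)
    (h : X -> T) :
  (forall x y, x >=< y -> h x = h y) -> forall x y, rho x y -> h x = h y.
Proof.
move=> hc x y [s [ps <-]]; elim: s x ps => //= z s IH x /andP[xz ps].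
by rewrite (hc _ _ xz) IH.
Qed.

(** * Extending isotone maps when components embed in the integers *)

Section Extension.
Context (d : Order.disp_t) (X : porderType d).

Lemma component_embedding :
  (forall B : set X, cardinally_indecomposable_component B ->
     exists C : set int, order_isomorphic B C) ->
  forall x : X, exists phi : X -> int,
    forall y z, rho x y -> rho x z -> (phi y <= phi z) = (y <= z).
Proof.
move=> iX x; have [|C [f [_ fmono]]] := iX [set b | rho x b]; first by exists x.
(* The value 0 off the component of [x] is a dummy: comparisons are only claimed inside it. *)
pose phi y := if pselect (rho x y) is left xy
              then val (f (exist _ y (mem_set xy))) else Posz 0.
exists phi => y z xy xz; rewrite /phi.
case: pselect => // ?; case: pselect => // ?.
exact: fmono.
Qed.

Hypothesis emb : forall x : X, exists phi : X -> int,
  forall y z, rho x y -> rho x z -> (phi y <= phi z) = (y <= z).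

Lemma rho_comparable (x y : X) : rho x y -> x >=< y.
Proof.
move=> xy; have [phi phiE] := emb x; rewrite /Order.comparable.
by rewrite -!phiE//; [exact: le_total | exact: rho_refl..].
Qed.

(** All of [S] lies in the component of [u], with images at most [phi u], so an element whose image
    is nearest to [phi u] is greatest. *)
Lemma embedding_bounded_have_max : bounded_have_max X.
Proof.
move=> S u S0 Su; have [phi phiE] := emb u.
have uS s : S s -> rho u s by move=> /Su/le_rho/rho_sym.
have [m Sm minm] := exists_argmin (fun s => absz (phi u - phi s)%R) S0.
exists m => // s Ss; rewrite -phiE; [|exact: uS..].
move: (minm s Ss) (Su s Ss) (Su m Sm).
rewrite -!(phiE _ u); do ?[exact: rho_refl | exact: uS].
lia.
Qed.

Lemma embedding_bounded_have_min : bounded_have_min X.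
Proof.
move=> S u S0 Su; have [phi phiE] := emb u.
have uS s : S s -> rho u s by move=> /Su/le_rho.
have [m Sm minm] := exists_argmin (fun s => absz (phi u - phi s)%R) S0.
exists m => // s Ss; rewrite -phiE; [|exact: uS..].
move: (minm s Ss) (Su s Ss) (Su m Sm).
rewrite -!(phiE u); do ?[exact: rho_refl | exact: uS].
lia.
Qed.

Lemma isotone_extension (A : set X) (d' : Order.disp_t) (Y : porderType d')
    (f : A -> Y) :
  inhabited Y -> isotone f ->
  exists g : X -> Y, isotone g /\ (forall a : A, g (val a) = f a).
Proof.
move=> [y0] fiso.
pose below x (a : A) := val a <= x.
pose above x (a : A) := x <= val a.
(* The fallback [y0] serves points comparable to no element of [A]; as components are chains, these
   form the components that miss [A]. *)
pose P x y :=
  (exists a, [/\ below x a, forall b, below x b -> val b <= val a & y = f a]) \/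
  (~ (exists a, below x a) /\
   ((exists a, [/\ above x a, forall b, above x b -> val a <= val b & y = f a])
    \/ (~ (exists a, above x a) /\ y = y0))).
have exP x : exists y, P x y.
  have [[a0 a0x]|nb] := pselect (exists a, below x a).
    have [||_ [a ax <-] amax] :=
      @embedding_bounded_have_max [set val a | a in below x] x.
    - by exists (val a0), a0.
    - by move=> _ [a ax <-].
    - exists (f a); left; exists a; split=> // b bx.
      by apply: amax; exists b.
  have [[a0 a0x]|na] := pselect (exists a, above x a); last first.
    by exists y0; right; split=> //; right.
  have [||_ [a ax <-] amin] :=
    @embedding_bounded_have_min [set val a | a in above x] x.
  - by exists (val a0), a0.
  - by move=> _ [a ax <-].
  - exists (f a); right; split=> //; left; exists a; split=> // b bx.
    by apply: amin; exists b.
have [g gP] := choice exP.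
exists g; split; last first.
  move=> a; have [[b [ba bmax ->]]|[nb _]] := gP (val a).
    by congr f; apply/val_inj/le_anti/andP; split => //; apply: bmax; exact: lexx.
  by case: nb; exists a; exact: lexx.
move=> x y xy.
have cmp (a b : X) : rho x a -> rho x b -> a >=< b.
  by move=> xa xb; apply: rho_comparable; exact: rho_trans (rho_sym xa) xb.
have xry := le_rho xy.
case: (gP x) (gP y) => [[a [ax amax ->]]|[nbx gx]].
  have ay : below y a by exact: le_trans ax xy.
  case=> [[b [_ bmax ->]]|[nb _]]; last by case: nb; exists a.
  by apply: fiso; exact: bmax.
case=> [[b [bby bmax ->]]|[nby gy]].
  (* In the chain containing [x], [y] and [b], the point [x] has nothing of [A] below it, so [b]
     must lie above [x]. *)
  have xb : above x b.
    have /orP[//|bx] : x >=< val b.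
      apply: cmp; first exact: rho_refl.
      exact: rho_trans xry (rho_sym (le_rho bby)).
    by case: nbx; exists b.
  case: gx => [[a [ax amin ->]]|[na _]]; last by case: na; exists b.
  by apply: fiso; exact: amin.
case: gx gy => [[a [ax amin ->]]|[nax ->]].
  case=> [[b [byb bmin ->]]|[nay _]].
    by apply: fiso; apply: amin; exact: le_trans byb.
  (* An element of [A] above [x] is comparable to [y], so [y] cannot be a fallback point. *)
  have /orP[ya|ay] := cmp _ _ xry (le_rho ax); first by case: nay; exists a.
  by case: nby; exists a.
case=> [[b [byb _ _]]|[_ ->]]; last exact: lexx.
by case: nax; exists b; exact: le_trans byb.
Qed.

End Extension.

(** * Consequences of retractions onto nonempty subsets *)

Section Retraction.
Context (d : Order.disp_t) (X : porderType d).

Lemma extension_retract :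
  (forall (A : set X) (d' : Order.disp_t) (Y : porderType d'),
     inhabited Y -> forall f : A -> Y, isotone f ->
     exists g : X -> Y, isotone g /\ (forall a : A, g (val a) = f a)) ->
  all_subsets_retract X.
Proof.
move=> ext A [a0 Aa0].
have [||g [giso gE]] := ext A _ A _ id; first by split; exists a0; exact: mem_set.
  by move=> x y.
exists (val \o g); split=> [x y /giso //|x|a Aa].
  exact: set_mem (valP (g x)).
by rewrite /= -[a]/(val (exist _ a (mem_set Aa) : A)) gE.
Qed.

Hypothesis ret : all_subsets_retract X.

Lemma retract_rho_comparable (x y : X) : rho x y -> x >=< y.
Proof.
move=> xy; apply: contrapT => nxy.
have [|g [giso gA gid]] := ret (A := [set z | z = x \/ z = y]).
  by exists x; left.
(* Images of comparable points are comparable, which in the antichain of [x] and [y] means equal. *)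
have gle a b : a <= b -> g a = g b.
  move=> /giso; case: (gA a) => ->; case: (gA b) => -> // le; case: nxy.
    by rewrite /Order.comparable le.
  by rewrite /Order.comparable le orbT.
have gxy : g x = g y.
  by apply: rho_invariant xy => a b /orP[/gle|/gle/esym].
by apply: nxy; rewrite -(gid x) ?gxy ?gid; [exact: comparablexx|right|left].
Qed.

Lemma retract_bounded_have_max (B : set X) : bounded_have_max B.
Proof.
move=> S u [s0 Ss0] Su.
have [|g [giso gA gid]] := ret (A := val @` S); first by exists (val s0), s0.
have [m Sm gm] := gA (val u); exists m => // s Ss.
have := giso _ _ (Su s Ss : val s <= val u).
by rewrite -gm gid//; exists s.
Qed.

Lemma retract_bounded_have_min (B : set X) : bounded_have_min B.
Proof.
move=> S u [s0 Ss0] Su.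
have [|g [giso gA gid]] := ret (A := val @` S); first by exists (val s0), s0.
have [m Sm gm] := gA (val u); exists m => // s Ss.
have := giso _ _ (Su s Ss : val u <= val s).
by rewrite -gm gid//; exists s.
Qed.

End Retraction.

(** * Embedding a chain in the integers *)

Section Chain.
Context (d : Order.disp_t) (T : porderType d).
Hypothesis tot : forall x y : T, x >=< y.
Hypothesis hmax : bounded_have_max T.
Hypothesis hmin : bounded_have_min T.

Lemma exists_successor : exists s : T -> T,
  (forall x, x <= s x) /\ (forall x y, x < y -> x < s x <= y).
Proof.
have exS (x : T) : exists z, x <= z /\ forall y, x < y -> x < z <= y.
  have [[y0 xy0]|no] := pselect (exists y, x < y).
    have [||z xz zmin] := @hmin [set y | x < y] x; first by exists y0.
      by move=> y /ltW.
    by exists z; split=> [|y xy]; [exact: ltW | rewrite [x < z]xz zmin].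
  (* A maximal element is its own successor. *)
  by exists x; split=> [|y xy]; [exact: lexx | case: no; exists y].
have [s sP] := choice exS.
by exists s; split=> x => [|y]; have [le lt] := sP x; [|exact: lt].
Qed.

Lemma exists_int_embedding (a : T) :
  exists phi : T -> int, {mono phi : x y / x <= y}.
Proof.
have [s [s_ge s_lt]] := exists_successor.
have iter_ge n x : x <= iter n s x.
  by elim: n => [|n IH] /=; [exact: lexx | exact: le_trans (s_ge _)].
have iter_homo x m n : (m <= n)%N -> iter m s x <= iter n s x.
  by move=> /subnK <-; rewrite iterD.
have reach x y : x <= y -> exists n, iter n s x == y.
  move=> xy.
  (* Take the greatest iterate below [y]: were it not [y], its successor would be a larger one. *)
  have [||_ [[n ->] ny] nmax] :=
    @hmax [set z | (exists n, z = iter n s x) /\ z <= y] y.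
  - by exists x; split=> //; exists 0%N.
  - by move=> z [].
  exists n; apply: contrapT => /negP ne.
  have /s_lt/andP[lt le] : iter n s x < y by rewrite lt_neqAle ne.
  have : s (iter n s x) <= iter n s x by apply: nmax; split=> //; exists n.+1.
  by move=> /(lt_le_trans lt); rewrite ltxx.
(* A maximal element is fixed by [s], so the least number of steps is needed. *)
have exdist x y : exists n, x <= y -> iter n s x = y /\
    forall k, iter k s x = y -> (n <= k)%N.
  have [/reach ex|_] := boolP (x <= y); last by exists 0%N.
  case: (ex_minnP ex) => n /eqP nE nmin; exists n => _; split=> // k /eqP.
  exact: nmin.
pose dist x y := projT1 (cid (exdist x y)).
have distP x y : x <= y -> iter (dist x y) s x = y /\
    forall k, iter k s x = y -> (dist x y <= k)%N.
  by rewrite /dist; case: cid.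
(* Signed number of successor steps from the base point [a]. *)
pose phi x : int := if a <= x then Posz (dist a x) else (- Posz (dist x a))%R.
have phi_lt x y : x < y -> phi x < phi y.
  move=> xy; rewrite /phi; case: ifPn => ax.
    have ay : a <= y := le_trans ax (ltW xy).
    have [[dx _] [dy _]] := (distP _ _ ax, distP _ _ ay).
    rewrite ay; suff : (dist a x < dist a y)%N by lia.
    by rewrite ltnNge; apply: contraTN xy => /(iter_homo a); rewrite dx dy => /le_gtF->.
  have xa : x < a.
    have := tot x a; rewrite /Order.comparable (negPf ax) orbF lt_neqAle => ->.
    by rewrite andbT; apply: contraNneq ax => ->; exact: lexx.
  have [dx _] := distP _ _ (ltW xa).
  (* When [x < a <= y], it suffices that [phi x] is negative. *)
  case: ifPn => ay.
    suff : dist x a != 0%N by lia.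
    by apply: contraTneq xa => d0; rewrite -dx d0 /= ltxx.
  have ya : y <= a by have := tot y a; rewrite /Order.comparable (negPf ay) orbF.
  have [dy dymin] := distP _ _ ya.
  (* Both points are below [a]. Some [j > 0] steps lead from [x] to [y], stopping short of [a]; the
     remaining [dist x a - j] steps lead from [y] to [a], which bounds the minimal count
     [dist y a]. *)
  have /reach[j /eqP jE] := ltW xy.
  have j0 : j != 0%N by apply: contraTneq xy => j0; rewrite -jE j0 /= ltxx.
  have jlt : (j < dist x a)%N.
    by rewrite ltnNge; apply: contra ay => /(iter_homo x); rewrite dx jE.
  have : (dist y a <= dist x a - j)%N.
    by apply: dymin; rewrite -jE -iterD subnK // ltnW.
  lia.
exists phi => x y; apply/idP/idP; last first.
  by rewrite le_eqVlt => /predU1P[->|/phi_lt/ltW//]; exact: lexx.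
apply: contraTT => nxy; rewrite -ltNge; apply: phi_lt.
have := tot x y; rewrite /Order.comparable (negPf nxy) /= lt_neqAle => yx.
by rewrite yx andbT; apply: contraNneq nxy => ->; exact: lexx.
Qed.

Lemma order_isomorphic_int_subset (a : T) :
  exists C : set int, order_isomorphic T C.
Proof.
have [phi phiE] := exists_int_embedding a.
have mem x : phi x \in range phi by apply: mem_set; exists x.
pose f x : range phi := exist _ (phi x) (mem x).
have exg (c : range phi) : exists x, phi x = val c.
  by have [x _ <-] := set_mem (valP c); exists x.
have [g gP] := choice exg.
exists (range phi), f; split; last exact: phiE.
exists g => [x|c]; last by apply: val_inj; exact: gP.
by have := gP (f x); exact: (inc_inj phiE).
Qed.

End Chain.

Theorem theorem3p11 (d : Order.disp_t) (X : porderType d) :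
  (forall B : set X, cardinally_indecomposable_component B ->
     exists C : set int, order_isomorphic B C)
  <->
  (forall (A : set X) (d' : Order.disp_t) (Y : porderType d'),
     inhabited Y ->
     forall f : A -> Y, isotone f ->
     exists g : X -> Y, isotone g /\ (forall a : A, g (val a) = f a)).
Proof.
split=> [/component_embedding emb A d' Y Y0 f|/extension_retract ret B [a Ba]].
  exact: isotone_extension.
have aB : a \in B by rewrite Ba; apply: mem_set; exact: rho_refl.
apply: (order_isomorphic_int_subset _ _ _ (exist _ a aB : B)).
- move=> x y; apply: (retract_rho_comparable ret).
  have rB (z : B) : rho a (val z) by have := set_mem (valP z); rewrite {1}Ba.
  exact: rho_trans (rho_sym (rB x)) (rB y).
- exact: retract_bounded_have_max.
- exact: retract_bounded_have_min.
Qed.
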